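(* Let $n\geq2$, let $\mathbf{x}=(\mathcal{U},\mathcal{W})$ be an $(n-1)$-smashing $t$-structure in a triangulated category $(\mathcal{D},\Sigma,\triangle)$ with coproducts, and let $\mathcal{C}_n:=\mathcal{W}\cap\Sigma^{-n+1}\mathcal{U}$. Then the following statements are equivalent. (a) $\mathbf{x}$ is $0$-smashing. (b) $\mathcal{C}_n$ is AET4. (c) $\mathcal{C}_n$ is AET3.5.
   Context: **$t$-structures.** A pair $(\mathcal{U},\mathcal{W})$ of full isomorphism-closed subcategories of $\mathcal{D}$ is a $t$-structure if $\mathrm{Hom}_{\mathcal{D}}(\mathcal{U},\Sigma^{-1}\mathcal{W})=0$, $\Sigma\mathcal{U}\subseteq\mathcal{U}$, and every $D\in\mathcal{D}$ lies in a distinguished triangle $U\to D\to\Sigma^{-1}W\to\Sigma U$ with $U\in\mathcal{U}$, $W\in\mathcal{W}$. For $k\geq0$, $\mathbf{x}$ is $k$-smashing if every coproduct in $\mathcal{D}$ of a family of objects of $\mathcal{W}$ lies in $\Sigma^k\mathcal{W}$ (so $0$-smashing means that $\mathcal{W}$ is closed under coproducts in $\mathcal{D}$). **Extriangulated structure.** A triangulated category is extriangulated (in the sense of Nakaoka–Palu) with $\mathbb{E}(X,Y)=\mathrm{Hom}_{\mathcal{D}}(X,\Sigma Y)$, where $h\in\mathbb{E}(X,Y)$ is realized by $Y\to Z\to X$ for any distinguished triangle $Y\to Z\to X\xrightarrow{h}\Sigma Y$. The extended heart $\mathcal{C}_n$ is closed under extensions in $\mathcal{D}$ and is extriangulated with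 the restricted structure: $\mathbb{E}(X,Y)=\mathrm{Hom}_{\mathcal{D}}(X,\Sigma Y)$ for $X,Y\in\mathcal{C}_n$ and the same realizations. For $\eta\in\mathbb{E}(X,Y)$, $a:Y\to Y'$, $c:X'\to X$, write $a\cdot\eta=\mathbb{E}(X,a)(\eta)$ and $\eta\cdot c=\mathbb{E}(c,Y)(\eta)$. **AET conditions** (for an extriangulated category $(\mathcal{C},\mathbb{E},\mathfrak{s})$; coproducts are taken in $\mathcal{C}$). $A^{(I)}$ is the coproduct of $I$ copies of $A$ and $\mu_i$ are canonical inclusions. $\mathcal{C}$ is AET3.5 if every family of objects indexed by a non-empty set has a coproduct in $\mathcal{C}$ and, for each non-empty set $I$, there is a natural transformation of $\mathrm{Ab}$-valued functors (natural in $\{B_i\}_{i\in I}$ and $A$) $\Gamma:\prod_{i\in I}\mathbb{E}(B_i,A)\to\mathbb{E}(\coprod_{i\in I}B_i,A^{(I)})$ such that, if $\eta_i$ is realized by $A\xrightarrow{f_i}E_i\xrightarrow{g_i}B_i$ for all $i$, then $\Gamma(\eta_i)_{i\in I}$ is realized by $A^{(I)}\xrightarrow{\coprod f_i}\coprod E_i\xrightarrow{\coprod g_i}\coprod B_i$. $\mathcal{C}$ is AET4 if, in addition, $\Gamma$ can be chosen with $\Gamma(\eta_i)_{i\in I}\cdot\mu_j^B=\mu_j^A\cdot\eta_j$ for all $j\in I$. *)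

(* Defs.v *)
From mathcomp Require Import all_boot all_algebra.

Set Implicit Arguments.
Unset Strict Implicit.
Unset Printing Implicit Defensive.

Import GRing.Theory.
Local Open Scope ring_scope.

Declare Scope cat_scope.
Delimit Scope cat_scope with cat.
Open Scope cat_scope.

(* All families are indexed by types of this one universe, which is not
   constrained by the universes of objects and morphisms; a category can have
   "all coproducts" without having them for families as large as itself. *)
Definition index_set := Type.

Record preadditive := Preadditive {
  obj :> Type;
  hom : obj -> obj -> zmodType;
  idm : forall X, hom X X;
  compm : forall X Y Z, hom Y Z -> hom X Y -> hom X Z;
  compm_id_l : forall X Y (f : hom X Y), compm (idm Y) f = f;
  compm_id_r : forall X Y (f : hom X Y), compm f (idm X) = f;
  compm_assoc : forall X Y Z T (h : hom Z T) (g : hom Y Z) (f : hom X Y),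
    compm h (compm g f) = compm (compm h g) f;
  compm_add_l : forall X Y Z (g g' : hom Y Z) (f : hom X Y),
    compm (g + g') f = compm g f + compm g' f;
  compm_add_r : forall X Y Z (g : hom Y Z) (f f' : hom X Y),
    compm g (f + f') = compm g f + compm g f'
}.

Arguments hom {p} X Y.
Arguments idm {p} X.
Arguments compm {p X Y Z} g f.

Notation "g \oc f" := (compm g f)
  (at level 40, left associativity, format "g  \oc  f") : cat_scope.

Section Basics.
Variable C : preadditive.

Definition is_iso (X Y : C) (f : hom X Y) : Prop :=
  exists g : hom Y X, g \oc f = idm X /\ f \oc g = idm Y.

Definition isomorphic (X Y : C) : Prop := exists f : hom X Y, is_iso f.

Definition iso_closed (P : C -> Prop) : Prop :=
  forall X Y : C, isomorphic X Y -> P X -> P Y.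

Definition is_zero (X : C) : Prop :=
  (forall (Y : C) (f : hom X Y), f = 0) /\ (forall (Y : C) (f : hom Y X), f = 0).

Definition has_zero_object : Prop := exists X : C, is_zero X.

Definition has_biproducts : Prop :=
  forall X Y : C, exists (Z : C) (i1 : hom X Z) (i2 : hom Y Z)
    (p1 : hom Z X) (p2 : hom Z Y),
    [/\ p1 \oc i1 = idm X, p2 \oc i2 = idm Y, p1 \oc i2 = 0, p2 \oc i1 = 0
      & i1 \oc p1 + i2 \oc p2 = idm Z].

Record coproduct (I : index_set) (B : I -> C) := Coproduct {
  cop_obj :> C;
  inj : forall i, hom (B i) cop_obj;
  desc : forall X : C, (forall i, hom (B i) X) -> hom cop_obj X;
  desc_inj : forall (X : C) (f : forall i, hom (B i) X) i,
    desc f \oc inj i = f i;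
  desc_uniq : forall (X : C) (f : forall i, hom (B i) X) (g : hom cop_obj X),
    (forall i, g \oc inj i = f i) -> g = desc f
}.

Definition cop_map (I : index_set) (B B' : I -> C)
    (c : coproduct B) (c' : coproduct B') (f : forall i, hom (B i) (B' i)) :
    hom (cop_obj c) (cop_obj c') :=
  desc c (fun i => inj c' i \oc f i).

Definition has_coproducts : Prop :=
  forall (I : index_set) (B : I -> C), inhabited (coproduct B).

Definition has_nonempty_coproducts : Prop :=
  forall (I : index_set), inhabited I ->
  forall B : I -> C, inhabited (coproduct B).

End Basics.

Arguments inj {C I B} c i : rename.
Arguments desc {C I B} c {X} f : rename.

(* The suspension is an additive autoequivalence; it need not be a strict
   automorphism, and no quasi-inverse is chosen. *)
Record triangulated := Triangulated {
  tri_base :> preadditive;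
  tri_zero : has_zero_object tri_base;
  tri_biproducts : has_biproducts tri_base;
  susp : tri_base -> tri_base;
  suspm : forall X Y : tri_base, hom X Y -> hom (susp X) (susp Y);
  suspm_id : forall X : tri_base, suspm (idm X) = idm (susp X);
  suspm_comp : forall (X Y Z : tri_base) (g : hom Y Z) (f : hom X Y),
    suspm (g \oc f) = suspm g \oc suspm f;
  suspm_add : forall (X Y : tri_base) (f g : hom X Y),
    suspm (f + g) = suspm f + suspm g;
  suspm_faithful : forall X Y : tri_base, injective (@suspm X Y);
  suspm_full : forall (X Y : tri_base) (g : hom (susp X) (susp Y)),
    exists f : hom X Y, suspm f = g;
  susp_ess_surj : forall Y : tri_base, exists X, isomorphic (susp X) Y;
  dist : forall X Y Z : tri_base,
    hom X Y -> hom Y Z -> hom Z (susp X) -> Prop;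
  dist_iso : forall (X Y Z X' Y' Z' : tri_base)
      (f : hom X Y) (g : hom Y Z) (h : hom Z (susp X))
      (f' : hom X' Y') (g' : hom Y' Z') (h' : hom Z' (susp X'))
      (u : hom X X') (v : hom Y Y') (w : hom Z Z'),
    is_iso u -> is_iso v -> is_iso w ->
    v \oc f = f' \oc u -> w \oc g = g' \oc v -> suspm u \oc h = h' \oc w ->
    dist f g h -> dist f' g' h';
  dist_id : forall X Z : tri_base, is_zero Z ->
    dist (idm X) (0 : hom X Z) (0 : hom Z (susp X));
  dist_cone : forall (X Y : tri_base) (f : hom X Y),
    exists (Z : tri_base) (g : hom Y Z) (h : hom Z (susp X)), dist f g h;
  dist_rotate : forall (X Y Z : tri_base)
      (f : hom X Y) (g : hom Y Z) (h : hom Z (susp X)),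
    dist f g h <-> dist g h (- suspm f);
  dist_morphism : forall (X Y Z X' Y' Z' : tri_base)
      (f : hom X Y) (g : hom Y Z) (h : hom Z (susp X))
      (f' : hom X' Y') (g' : hom Y' Z') (h' : hom Z' (susp X'))
      (u : hom X X') (v : hom Y Y'),
    dist f g h -> dist f' g' h' -> v \oc f = f' \oc u ->
    exists w : hom Z Z', w \oc g = g' \oc v /\ suspm u \oc h = h' \oc w;
  dist_octahedron : forall (X Y Z X' Y' Z' : tri_base)
      (f : hom X Y) (f1 : hom Y Z') (f2 : hom Z' (susp X))
      (g : hom Y Z) (g1 : hom Z X') (g2 : hom X' (susp Y))
      (h1 : hom Z Y') (h2 : hom Y' (susp X)),
    dist f f1 f2 -> dist g g1 g2 -> dist (g \oc f) h1 h2 ->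
    exists (u : hom Z' Y') (v : hom Y' X'),
      [/\ dist u v (suspm f1 \oc g2),
          u \oc f1 = h1 \oc g, h2 \oc u = f2,
          v \oc h1 = g1 & g2 \oc v = suspm f \oc h2]
}.

Arguments susp {t} X.
Arguments suspm {t X Y} f.
Arguments dist {t X Y Z} f g h.

Section TStructures.
Variable D : triangulated.

Definition susp_iter (k : nat) (X : D) : D := iter k (@susp D) X.

(* Full isomorphism-closed subcategories are isomorphism-closed predicates P on
   objects; susp_sub k P is the essential image of P under the k-th power of
   the suspension, and desusp_sub k P the one under the (-k)-th power: when P
   is isomorphism-closed, the latter consists of the objects whose k-th
   suspension is in P. *)
Definition susp_sub (k : nat) (P : D -> Prop) : D -> Prop :=
  fun X => exists Y : D, P Y /\ isomorphic (susp_iter k Y) X.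

Definition desusp_sub (k : nat) (P : D -> Prop) : D -> Prop :=
  fun X => P (susp_iter k X).

Record t_structure (U W : D -> Prop) : Prop := TStructure {
  t_iso_closed_l : iso_closed U;
  t_iso_closed_r : iso_closed W;
  t_hom : forall X Y : D, U X -> desusp_sub 1 W Y ->
    forall f : hom X Y, f = 0;
  t_susp : forall X : D, U X -> U (susp X);
  t_triangle : forall X : D, exists (A B : D)
      (f : hom A X) (g : hom X B) (h : hom B (susp A)),
    [/\ U A, desusp_sub 1 W B & dist f g h]
}.

Definition smashing (k : nat) (W : D -> Prop) : Prop :=
  forall (I : index_set) (B : I -> D), (forall i, W (B i)) ->
  forall c : coproduct B, susp_sub k W c.

Definition extended_heart (n : nat) (U W : D -> Prop) : D -> Prop :=
  fun X => W X /\ desusp_sub (n - 1) U X.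

End TStructures.

(* The data (C, E, s) of an extriangulated category, with E a biadditive
   bifunctor. The relation realizes eta f g means that the sequence (f, g) belongs
   to the class s(eta). The remaining axioms of extriangulated categories are
   omitted: the AET conditions are expressed by the data alone. *)
Record extri := Extri {
  extri_base :> preadditive;
  ext : extri_base -> extri_base -> zmodType;
  pushE : forall X Y Y' : extri_base, hom Y Y' -> ext X Y -> ext X Y';
  pullE : forall X X' Y : extri_base, ext X Y -> hom X' X -> ext X' Y;
  pushE_id : forall (X Y : extri_base) (e : ext X Y), pushE (idm Y) e = e;
  pullE_id : forall (X Y : extri_base) (e : ext X Y), pullE e (idm X) = e;
  pushE_comp : forall (X Y Y' Y'' : extri_base) (b : hom Y' Y'')
      (a : hom Y Y') (e : ext X Y),
    pushE (b \oc a) e = pushE b (pushE a e);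
  pullE_comp : forall (X X' X'' Y : extri_base) (e : ext X Y)
      (c : hom X' X) (d : hom X'' X'),
    pullE e (c \oc d) = pullE (pullE e c) d;
  push_pullE : forall (X X' Y Y' : extri_base) (a : hom Y Y') (e : ext X Y)
      (c : hom X' X),
    pushE a (pullE e c) = pullE (pushE a e) c;
  pushE_add : forall (X Y Y' : extri_base) (a : hom Y Y') (e e' : ext X Y),
    pushE a (e + e') = pushE a e + pushE a e';
  pullE_add : forall (X X' Y : extri_base) (e e' : ext X Y) (c : hom X' X),
    pullE (e + e') c = pullE e c + pullE e' c;
  pushE_add_hom : forall (X Y Y' : extri_base) (a a' : hom Y Y') (e : ext X Y),
    pushE (a + a') e = pushE a e + pushE a' e;
  pullE_add_hom : forall (X X' Y : extri_base) (e : ext X Y) (c c' : hom X' X),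
    pullE e (c + c') = pullE e c + pullE e c';
  realizes : forall X Y Z : extri_base, ext X Y -> hom Y Z -> hom Z X -> Prop
}.

Arguments ext {e} X Y : rename.
Arguments pushE {e X Y Y'} a eta : rename.
Arguments pullE {e X X' Y} eta c : rename.
Arguments realizes {e X Y Z} eta f g : rename.

Section AET.
Variable C : extri.

Section Gamma.
Variables (I : index_set) (cop : forall B : I -> C, coproduct B).

Let copower (A : C) : coproduct (fun _ : I => A) := cop (fun _ => A).

Definition gamma_type : Type := forall (B : I -> C) (A : C),
  (forall i, ext (B i) A) -> ext (cop_obj (cop B)) (cop_obj (copower A)).

Variable Gamma : gamma_type.

Definition gamma_additive : Prop :=
  forall (B : I -> C) (A : C) (eta eta' : forall i, ext (B i) A),
  Gamma (fun i => eta i + eta' i) = Gamma eta + Gamma eta'.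

Definition gamma_natural : Prop :=
  forall (B B' : I -> C) (A A' : C) (b : forall i, hom (B' i) (B i))
    (a : hom A A') (eta : forall i, ext (B i) A),
  Gamma (fun i => pushE a (pullE (eta i) (b i))) =
  pushE (cop_map (copower A) (copower A') (fun _ => a))
    (pullE (Gamma eta) (cop_map (cop B') (cop B) b)).

Definition gamma_realizes : Prop :=
  forall (B E : I -> C) (A : C) (eta : forall i, ext (B i) A)
    (f : forall i, hom A (E i)) (g : forall i, hom (E i) (B i)),
  (forall i, realizes (eta i) (f i) (g i)) ->
  realizes (Gamma eta) (cop_map (copower A) (cop E) f)
    (cop_map (cop E) (cop B) g).

Definition gamma_inclusions : Prop :=
  forall (B : I -> C) (A : C) (eta : forall i, ext (B i) A) (j : I),
  pullE (Gamma eta) (inj (cop B) j) = pushE (inj (copower A) j) (eta j).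

End Gamma.

(* Gamma is a transformation between functors built from a choice cop of
   I-indexed coproducts. Existence of Gamma does not depend on this choice. *)
Definition AET35 : Prop :=
  has_nonempty_coproducts C /\
  forall (I : index_set), inhabited I ->
  exists (cop : forall B : I -> C, coproduct B) (Gamma : gamma_type cop),
    [/\ gamma_additive Gamma, gamma_natural Gamma & gamma_realizes Gamma].

Definition AET4 : Prop :=
  has_nonempty_coproducts C /\
  forall (I : index_set), inhabited I ->
  exists (cop : forall B : I -> C, coproduct B) (Gamma : gamma_type cop),
    [/\ gamma_additive Gamma, gamma_natural Gamma, gamma_realizes Gamma
      & gamma_inclusions Gamma].

End AET.

Definition full_subcategory (C : preadditive) (P : C -> Prop) : preadditive :=
  @Preadditive {X : C | P X} (fun X Y => hom (sval X) (sval Y))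
    (fun X => idm (sval X)) (fun X Y Z g f => g \oc f)
    (fun X Y f => compm_id_l f) (fun X Y f => compm_id_r f)
    (fun X Y Z T h g f => compm_assoc h g f)
    (fun X Y Z g g' f => compm_add_l g g' f)
    (fun X Y Z g f f' => compm_add_r g f f').

Definition extri_of_triangulated (D : triangulated) : extri.
Proof.
refine (@Extri D (fun X Y => hom X (susp Y))
  (fun X Y Y' a e => suspm a \oc e) (fun X X' Y e c => e \oc c)
  _ _ _ _ _ _ _ _ _ (fun X Y Z h f g => dist f g h)).
- by move=> X Y e; rewrite suspm_id compm_id_l.
- by move=> X Y e; rewrite compm_id_r.
- by move=> X Y Y' Y'' b a e; rewrite suspm_comp compm_assoc.
- by move=> X X' X'' Y e c d; rewrite compm_assoc.
- by move=> X X' Y Y' a e c; rewrite compm_assoc.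
- by move=> X Y Y' a e e'; rewrite compm_add_r.
- by move=> X X' Y e e' c; rewrite compm_add_l.
- by move=> X Y Y' a a' e; rewrite suspm_add compm_add_l.
- by move=> X X' Y e c c'; rewrite compm_add_r.
Defined.

Definition extri_restrict (C : extri) (P : C -> Prop) : extri :=
  @Extri (full_subcategory P) (fun X Y => ext (sval X) (sval Y))
    (fun X Y Y' a e => pushE a e) (fun X X' Y e c => pullE e c)
    (fun X Y e => pushE_id e) (fun X Y e => pullE_id e)
    (fun X Y Y' Y'' b a e => pushE_comp b a e)
    (fun X X' X'' Y e c d => pullE_comp e c d)
    (fun X X' Y Y' a e c => push_pullE a e c)
    (fun X Y Y' a e e' => pushE_add a e e')
    (fun X X' Y e e' c => pullE_add e e' c)
    (fun X Y Y' a a' e => pushE_add_hom a a' e)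
    (fun X X' Y e c c' => pullE_add_hom e c c')
    (fun X Y Z e f g => realizes e f g).

Definition heart_extri (D : triangulated) (n : nat) (U W : D -> Prop) : extri :=
  @extri_restrict (extri_of_triangulated D) (extended_heart n U W).

(* Main.v *)
From Pilot Require Import Defs.
From mathcomp Require Import all_boot all_algebra.
From Stdlib Require Import Classical IndefiniteDescription.
(* [hom] is to denote morphism groups, not spaces of linear maps. *)
Import Pilot.Defs.

(** In terms of the filtration of [D] by the shifts of [W], let W_k consist of
    the objects whose k-th suspension is in [W], so that W_0 = [W] and W_(k+1)
    is contained in W_k.

    If [W] is closed under coproducts, so is the heart, because [U] is a left
    orthogonal and thus always closed under them. Coproducts in the heart are
    then coproducts in [D], and Gamma sends a family [eta i : B i -> susp A] to
    the unique map from the coproduct of the [B i] to [susp A^(I)] with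
    components [suspm (inj i) \oc eta i]; it is realized as required because
    coproducts of distinguished triangles are distinguished
    ([coproduct_dist], [AET4_of_smashing]). AET4 contains AET3.5.

    Conversely assume AET3.5. Being (n-1)-smashing means that coproducts of
    families in W_(n-1) are in [W]; the aim is to lower n-1 to 0 one step at a
    time ([coproducts_in_W_descent]). So suppose that families in W_(k+1) have
    their coproduct in W_0; it is enough to show that it is even in W_1, since
    a desuspension then gives families in W_k with coproduct in W_0.
    Truncation splits the family into a part in W_n, whose coproduct is in W_1
    because of (n-1)-smashing, and a part in W_1 whose (n-1)-st suspension
    is in [U]. The coproduct [c] of the second part lies in the heart, and so
    do the suspensions [susp (B i)] of its members. This is where AET3.5 enters
    ([heart_coproduct_coaisle]): Gamma, applied to the extensions of
    [susp (B i)] by [c] given by the suspended inclusions, yields a triangle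
    [c^(I) -> coprod E i -> P] with [P] in the heart. The inclusions induce a map
    [m : c -> c^(I)], split by the codiagonal, which dies in [coprod E i]. For a
    map [t] from [U] to [c], the composite [m t] then factors through the
    desuspension of [P], which is in W_1; so [m t], and hence [t], vanishes. *)

Set Implicit Arguments.
Unset Strict Implicit.
Unset Printing Implicit Defensive.

Import GRing.Theory.
Local Open Scope ring_scope.

(** * Preadditive categories and coproducts *)

Lemma dependent_choice_family (I : Type) (T : I -> Type)
    (P : forall i, T i -> Prop) :
  (forall i, exists x, P i x) -> exists f : forall i, T i, forall i, P i (f i).
Proof.
move=> H; exists (fun i => proj1_sig (constructive_indefinite_description _ (H i))).
by move=> i; apply: proj2_sig.
Qed.

Section Preadditive.
Variable C : preadditive.

Lemma comp0m (X Y Z : C) (f : hom X Y) : (0 : hom Y Z) \oc f = 0.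
Proof. by apply: (addrI (0 \oc f)); rewrite -compm_add_l !addr0. Qed.

Lemma compm0 (X Y Z : C) (g : hom Y Z) : g \oc (0 : hom X Y) = 0.
Proof. by apply: (addrI (g \oc 0)); rewrite -compm_add_r !addr0. Qed.

Lemma compNm (X Y Z : C) (g : hom Y Z) (f : hom X Y) : (- g) \oc f = - (g \oc f).
Proof. by apply: (addrI (g \oc f)); rewrite -compm_add_l !subrr comp0m. Qed.

Lemma compmN (X Y Z : C) (g : hom Y Z) (f : hom X Y) : g \oc (- f) = - (g \oc f).
Proof. by apply: (addrI (g \oc f)); rewrite -compm_add_r !subrr compm0. Qed.

Lemma is_iso_id (X : C) : is_iso (idm X).
Proof. by exists (idm X); rewrite compm_id_l. Qed.

Lemma is_iso_opp (X Y : C) (f : hom X Y) : is_iso f -> is_iso (- f).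
Proof. by move=> [g [gf fg]]; exists (- g); rewrite !compNm !compmN !opprK. Qed.

Lemma isomorphic_sym (X Y : C) : isomorphic X Y -> isomorphic Y X.
Proof. by move=> [f [g [gf fg]]]; exists g, f. Qed.

Lemma is_zero_id (X : C) : idm X = 0 -> is_zero X.
Proof.
by move=> id0; split=> Y f; [rewrite -(compm_id_r f) id0 compm0
                            | rewrite -(compm_id_l f) id0 comp0m].
Qed.

Lemma coproduct_ext (I : index_set) (B : I -> C) (c : coproduct B) (X : C)
    (g g' : hom c X) :
  (forall i, g \oc inj c i = g' \oc inj c i) -> g = g'.
Proof. by move=> e; rewrite (desc_uniq e); apply/esym/desc_uniq. Qed.

Lemma cop_map_inj (I : index_set) (B B' : I -> C)
    (c : coproduct B) (c' : coproduct B') (f : forall i, hom (B i) (B' i)) i :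
  cop_map c c' f \oc inj c i = inj c' i \oc f i.
Proof. exact: desc_inj. Qed.

Lemma coproduct_isomorphic (I : index_set) (B B' : I -> C)
    (c : coproduct B) (c' : coproduct B') :
  (forall i, isomorphic (B i) (B' i)) -> isomorphic c c'.
Proof.
move=> /dependent_choice_family[f /dependent_choice_family[g fg]].
exists (cop_map c c' f), (cop_map c' c g).
split; [apply: (coproduct_ext (c := c)) | apply: (coproduct_ext (c := c'))] => i.
  by rewrite -compm_assoc cop_map_inj compm_assoc cop_map_inj -compm_assoc (fg i).1
    compm_id_l compm_id_r.
by rewrite -compm_assoc cop_map_inj compm_assoc cop_map_inj -compm_assoc (fg i).2
  compm_id_l compm_id_r.
Qed.

Section Universal.
Variables (I : index_set) (B : I -> C) (Z : C) (j : forall i, hom (B i) Z).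
Hypothesis ex : forall (X : C) (f : forall i, hom (B i) X),
  exists g : hom Z X, forall i, g \oc j i = f i.
Hypothesis un : forall (X : C) (g g' : hom Z X),
  (forall i, g \oc j i = g' \oc j i) -> g = g'.

Let d (X : C) (f : forall i, hom (B i) X) : hom Z X :=
  proj1_sig (constructive_indefinite_description _ (ex f)).

Let dj (X : C) (f : forall i, hom (B i) X) i : d f \oc j i = f i.
Proof. exact: (proj2_sig (constructive_indefinite_description _ (ex f))). Qed.

Let du (X : C) (f : forall i, hom (B i) X) (g : hom Z X) :
  (forall i, g \oc j i = f i) -> g = d f.
Proof. by move=> e; apply: un => i; rewrite e dj. Qed.

Definition coproduct_of_universal : coproduct B := Coproduct dj du.
End Universal.

End Preadditive.

(** * Triangulated categories *)

Section Triangulated.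
Variable D : triangulated.

Lemma suspm0 (X Y : D) : suspm (0 : hom X Y) = 0.
Proof. by apply: (addrI (suspm (0 : hom X Y))); rewrite -suspm_add !addr0. Qed.

Lemma is_zero_susp (X : D) : is_zero X -> is_zero (susp X).
Proof. by move=> [z _]; apply: is_zero_id; rewrite -suspm_id (z _ (idm X)) suspm0. Qed.

Lemma susp_reflects_isomorphic (X Y : D) :
  isomorphic (susp X) (susp Y) -> isomorphic X Y.
Proof.
move=> [f [g [gf fg]]].
have [f' ef] := suspm_full f; have [g' eg] := suspm_full g.
exists f', g'; split; apply: suspm_faithful.
  by rewrite suspm_comp ef eg suspm_id.
by rewrite suspm_comp ef eg suspm_id.
Qed.

Lemma susp_preserves_isomorphic (X Y : D) :
  isomorphic X Y -> isomorphic (susp X) (susp Y).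
Proof.
move=> [f [g [gf fg]]]; exists (suspm f), (suspm g).
by rewrite -!suspm_comp gf fg !suspm_id.
Qed.

Lemma iter_preserves_isomorphic k (X Y : D) :
  isomorphic X Y -> isomorphic (susp_iter k X) (susp_iter k Y).
Proof.
by move=> e; elim: k => [//|k IH]; apply: susp_preserves_isomorphic.
Qed.

Section Exactness.
Variables (X Y Z : D) (f : hom X Y) (g : hom Y Z) (h : hom Z (susp X)).
Hypothesis T : dist f g h.

Lemma dist_comp1 : g \oc f = 0.
Proof.
have [O zO] := tri_zero D.
have [|w [+ _]] := dist_morphism (dist_id X zO) T (u := idm X) (v := f).
  by rewrite !compm_id_r.
by rewrite compm0.
Qed.

(** The triangle [T' -> 0 -> susp T' -> susp T'] maps to the rotation of the
    given one by [t], and the third component of such a map is the suspension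
    of a lift of [t]. *)
Lemma dist_weak_kernel (T' : D) (t : hom T' Y) :
  g \oc t = 0 -> exists s, f \oc s = t.
Proof.
move=> gt0; have [O zO] := tri_zero D.
have T1 := (dist_rotate _ _ _).1 (dist_id T' zO).
have T2 := (dist_rotate _ _ _).1 T.
have [|w [_ ew]] := dist_morphism T1 T2 (u := t) (v := 0).
  by rewrite comp0m gt0.
have [s es] := suspm_full w; exists s; apply: suspm_faithful.
move: ew; rewrite suspm_id compmN compm_id_r compNm => /oppr_inj ->.
by rewrite suspm_comp es.
Qed.

Lemma dist_weak_cokernel (T' : D) (t : hom Y T') :
  t \oc f = 0 -> exists s, s \oc g = t.
Proof.
move=> tf0; have [O zO] := tri_zero D.
have T1 : dist (0 : hom O T') (idm T') 0.
  apply/dist_rotate; rewrite suspm0 oppr0; apply: dist_id.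
  exact: is_zero_susp.
have [|w [ew _]] := dist_morphism T T1 (u := 0) (v := t).
  by rewrite comp0m tf0.
by exists w; rewrite ew compm_id_l.
Qed.

End Exactness.

Section ExactnessRotated.
Variables (X Y Z : D) (f : hom X Y) (g : hom Y Z) (h : hom Z (susp X)).
Hypothesis T : dist f g h.
Let T1 := (dist_rotate _ _ _).1 T.
Let T2 := (dist_rotate _ _ _).1 T1.

Lemma dist_comp3 : suspm f \oc h = 0.
Proof. by apply: oppr_inj; rewrite -compNm oppr0; apply: dist_comp1 T2. Qed.

Lemma dist_weak_kernel3 (T' : D) (t : hom T' (susp X)) :
  suspm f \oc t = 0 -> exists s, h \oc s = t.
Proof.
by move=> ft0; apply: (dist_weak_kernel T2); rewrite compNm ft0 oppr0.
Qed.

Lemma dist_weak_cokernel2 (T' : D) (t : hom Z T') :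
  t \oc g = 0 -> exists s, s \oc h = t.
Proof. exact: (dist_weak_cokernel T1). Qed.

Lemma dist_weak_cokernel3 (T' : D) (t : hom (susp X) T') :
  t \oc h = 0 -> exists s, s \oc suspm f = t.
Proof.
move=> /(dist_weak_cokernel T2)[s <-]; exists (- s).
by rewrite compNm compmN.
Qed.

(** Rotating three times suspends a triangle up to the sign of all three maps;
    changing the sign of the middle object leaves it on the last map only. *)
Lemma dist_susp : dist (suspm f) (suspm g) (- suspm h).
Proof.
have T3 := (dist_rotate _ _ _).1 T2.
apply: (dist_iso (u := idm _) (v := - idm _) (w := idm _) _ _ _ _ _ _ T3);
  rewrite ?suspm_id ?compm_id_l ?compm_id_r ?compNm ?compmN ?compm_id_l
    ?compm_id_r ?opprK //; try exact: is_iso_id.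
exact/is_iso_opp/is_iso_id.
Qed.

End ExactnessRotated.

Lemma dist_iter k (X Y Z : D) (f : hom X Y) (g : hom Y Z) (h : hom Z (susp X)) :
  dist f g h -> exists (f' : hom (susp_iter k X) (susp_iter k Y))
    (g' : hom (susp_iter k Y) (susp_iter k Z)) h', dist f' g' h'.
Proof.
move=> T; elim: k => [|k [f' [g' [h' T']]]]; first by exists f, g, h.
by exists (suspm f'), (suspm g'), (- suspm h'); apply: dist_susp.
Qed.

(** An endomorphism [e] of a triangle which is the identity on the first two
    objects is unipotent on the cone: [e - 1] kills [g], hence factors through
    [h], and [h] kills [e - 1], so that [(e - 1)^2 = 0]. *)
Lemma dist_endo_iso (X Y Z : D) (f : hom X Y) (g : hom Y Z)
    (h : hom Z (susp X)) (e : hom Z Z) :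
  dist f g h -> e \oc g = g -> h \oc e = h -> is_iso e.
Proof.
move=> T eg he; pose n := e - idm Z.
have [|s sh] := dist_weak_cokernel2 T (t := n).
  by rewrite compm_add_l compNm eg compm_id_l subrr.
have nn : n \oc n = 0.
  rewrite -{1}sh -compm_assoc [h \oc n]compm_add_r compmN he compm_id_r subrr.
  by rewrite compm0.
have -> : e = idm Z + n by rewrite addrC subrK.
exists (idm Z - n); split.
  by rewrite compm_add_r compm_add_l compm_add_l !compNm nn !compm_id_r
    compm_id_l oppr0 addr0 subrK.
by rewrite compm_add_r compmN compm_add_l compm_add_l nn !compm_id_r
  compm_id_l addr0 addrK.
Qed.

Lemma cone_unique (X Y Z Z' : D) (f : hom X Y) (g : hom Y Z)
    (h : hom Z (susp X)) (g' : hom Y Z') (h' : hom Z' (susp X)) :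
  dist f g h -> dist f g' h' -> isomorphic Z Z'.
Proof.
move=> T T'.
have e : idm Y \oc f = f \oc idm X by rewrite compm_id_l compm_id_r.
have [w [wg hw]] := dist_morphism T T' e.
have [w' [wg' hw']] := dist_morphism T' T e.
rewrite !suspm_id !compm_id_l !compm_id_r in wg wg' hw hw'.
have [a [aw _]] : is_iso (w' \oc w).
  apply: (dist_endo_iso T); first by rewrite -compm_assoc wg.
  by rewrite compm_assoc -hw'.
have [b [_ wb]] : is_iso (w \oc w').
  apply: (dist_endo_iso T'); first by rewrite -compm_assoc wg'.
  by rewrite compm_assoc -hw.
rewrite compm_assoc in aw; rewrite -compm_assoc in wb.
exists w, (a \oc w'); split=> //.
suff -> : a \oc w' = w' \oc b by [].
by rewrite -[a \oc w']compm_id_r -wb compm_assoc aw compm_id_l.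
Qed.

(** * Coproducts of triangles *)

Section SuspCoproduct.
Variables (I : index_set) (B : I -> D) (c : coproduct B).

Lemma susp_coproduct_exists (X : D) (f : forall i, hom (susp (B i)) X) :
  exists g : hom (susp c) X, forall i, g \oc suspm (inj c i) = f i.
Proof.
have [Y [a [b [_ ab]]]] := susp_ess_surj X.
have [f' ef] := dependent_choice_family (fun i => suspm_full (b \oc f i)).
exists (a \oc suspm (desc c f')) => i.
by rewrite -compm_assoc -suspm_comp desc_inj ef compm_assoc ab compm_id_l.
Qed.

Lemma susp_coproduct_ext (X : D) (g g' : hom (susp c) X) :
  (forall i, g \oc suspm (inj c i) = g' \oc suspm (inj c i)) -> g = g'.
Proof.
move=> e; have [Y [a [b [_ ab]]]] := susp_ess_surj X.
have [k ek] := suspm_full (b \oc g); have [k' ek'] := suspm_full (b \oc g').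
suff E : k = k'.
  by rewrite -[g]compm_id_l -[g']compm_id_l -ab -!compm_assoc -ek -ek' E.
apply: (coproduct_ext (c := c)) => i; apply: suspm_faithful.
by rewrite !suspm_comp ek ek' -!compm_assoc e.
Qed.

Definition susp_coproduct : coproduct (fun i => susp (B i)) :=
  coproduct_of_universal susp_coproduct_exists susp_coproduct_ext.

End SuspCoproduct.

Fixpoint iter_coproduct (I : index_set) (B : I -> D) (c : coproduct B) k :
    coproduct (fun i => susp_iter k (B i)) :=
  if k is k'.+1 then susp_coproduct (iter_coproduct c k') else c.

Lemma iter_coproductE (I : index_set) (B : I -> D) (c : coproduct B) k :
  cop_obj (iter_coproduct c k) = susp_iter k c.
Proof. by elim: k => //= k ->. Qed.

(** The triangles of the family map to any triangle on the coproduct [F] of the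
    [f i], which gives a map [w] from the coproduct of the cones to the cone of
    [F]. Morphisms into a test object turn both sequences into exact ones, the
    first being a product of the exact sequences of the components, so the
    five lemma shows that [w] is invertible. Its diagram chase is carried out
    by choosing lifts for each component. *)
Lemma coproduct_dist (I : index_set) (X Y Z : I -> D)
    (f : forall i, hom (X i) (Y i)) (g : forall i, hom (Y i) (Z i))
    (h : forall i, hom (Z i) (susp (X i)))
    (cX : coproduct X) (cY : coproduct Y) (cZ : coproduct Z) :
  (forall i, dist (f i) (g i) (h i)) ->
  dist (cop_map cX cY f) (cop_map cY cZ g)
    (desc cZ (fun i => suspm (inj cX i) \oc h i)).
Proof.
move=> T; set F := cop_map cX cY f; set G := cop_map cY cZ g.
set H := desc cZ _.
have [K [g' [h' T']]] := dist_cone F.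
have [w0 ew0] : exists w0 : forall i, hom (Z i) K, forall i,
    w0 i \oc g i = g' \oc inj cY i /\ suspm (inj cX i) \oc h i = h' \oc w0 i.
  apply: (dependent_choice_family (P := fun i (w : hom (Z i) K) =>
    w \oc g i = g' \oc inj cY i /\ suspm (inj cX i) \oc h i = h' \oc w)) => i.
  by apply: (dist_morphism (T i) T'); rewrite cop_map_inj.
pose w := desc cZ w0.
have w_inj i : w \oc inj cZ i = w0 i by apply: desc_inj.
have wG : w \oc G = g'.
  apply: (coproduct_ext (c := cY)) => i.
  by rewrite -compm_assoc cop_map_inj compm_assoc w_inj (ew0 i).1.
have hw : H = h' \oc w.
  apply: (coproduct_ext (c := cZ)) => i.
  by rewrite desc_inj -compm_assoc w_inj (ew0 i).2.
have w_epi (T0 : D) (p : hom K T0) : p \oc w = 0 -> p = 0.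
  move=> pw0.
  have [|q eq] := dist_weak_cokernel2 T' (t := p).
    by rewrite -wG compm_assoc pw0 comp0m.
  have [r er] : exists r : forall i, hom (susp (Y i)) T0,
      forall i, r i \oc suspm (f i) = q \oc suspm (inj cX i).
    apply: (dependent_choice_family (P := fun i (s : hom (susp (Y i)) T0) =>
      s \oc suspm (f i) = q \oc suspm (inj cX i))) => i.
    apply: (dist_weak_cokernel3 (T i)); rewrite -compm_assoc (ew0 i).2.
    by rewrite compm_assoc eq -w_inj compm_assoc pw0 comp0m.
  have [r' er'] := susp_coproduct_exists cY r.
  have -> : p = r' \oc (suspm F \oc h').
    rewrite -eq compm_assoc; congr (_ \oc _).
    apply: (susp_coproduct_ext (c := cX)) => i.
    by rewrite -compm_assoc -suspm_comp cop_map_inj suspm_comp compm_assoc er' er.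
  by rewrite (dist_comp3 T') compm0.
have [v vw] : exists v : hom K cZ, v \oc w = idm cZ.
  have [|p ep] := dist_weak_cokernel T' (t := G).
    apply: (coproduct_ext (c := cX)) => i.
    rewrite comp0m -compm_assoc cop_map_inj compm_assoc cop_map_inj -compm_assoc.
    by rewrite (dist_comp1 (T i)) compm0.
  have [q eq] : exists q : forall i, hom (susp (X i)) cZ,
      forall i, q i \oc h i = (idm cZ - p \oc w) \oc inj cZ i.
    apply: (dependent_choice_family (P := fun i (s : hom (susp (X i)) cZ) =>
      s \oc h i = (idm cZ - p \oc w) \oc inj cZ i)) => i.
    apply: (dist_weak_cokernel2 (T i)).
    rewrite -compm_assoc -(cop_map_inj cY cZ) compm_assoc -/G.
    by rewrite compm_add_l compNm compm_id_l -compm_assoc wG ep subrr comp0m.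
  have [q' eq'] := susp_coproduct_exists cX q.
  exists (p + q' \oc h'); apply: (coproduct_ext (c := cZ)) => i.
  rewrite -compm_assoc w_inj compm_add_l -[(q' \oc _) \oc _]compm_assoc.
  rewrite -(ew0 i).2 compm_assoc eq' eq.
  by rewrite compm_add_l compNm -compm_assoc w_inj addrC subrK.
have wv : w \oc v = idm K.
  apply/subr0_eq/w_epi.
  by rewrite compm_add_l compNm -compm_assoc vw compm_id_l compm_id_r subrr.
apply: (dist_iso (u := idm cX) (v := idm cY) (w := v) _ _ _ _ _ _ T').
- exact: is_iso_id.
- exact: is_iso_id.
- by exists w.
- by rewrite compm_id_l compm_id_r.
- by rewrite compm_id_r -wG compm_assoc vw compm_id_l.
- by rewrite suspm_id compm_id_l hw -compm_assoc wv compm_id_r.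
Qed.

End Triangulated.

(** * t-structures *)

Section TStructure.
Variables (D : triangulated) (U W : D -> Prop).
Hypothesis hx : t_structure U W.

(** In the truncation triangle [A -> X -> B] the second map is zero, so the
    first one, [f], has a section. It is also a monomorphism: a map from
    [susp A] to itself killed by [suspm f] factors through [B], and
    [Hom(susp A, B) = 0]. Hence [X] is isomorphic to [A]. *)
Lemma aisle_of_orthogonal (X : D) :
  (forall Y, W (susp Y) -> forall f : hom X Y, f = 0) -> U X.
Proof.
move=> orth; have [A [B [f [g [h [uA wB T]]]]]] := t_triangle hx X.
have [|s fs] := dist_weak_kernel T (t := idm X).
  by rewrite compm_id_r; apply: orth.
suff sf : s \oc f = idm A by apply: (t_iso_closed_l hx _ uA); exists f, s.
apply/subr0_eq/suspm_faithful; rewrite suspm0.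
have [|w <-] := dist_weak_kernel3 T (t := suspm (s \oc f - idm A)).
  by rewrite -suspm_comp compm_add_r compmN compm_assoc fs compm_id_l compm_id_r
    subrr suspm0.
by rewrite (t_hom hx (t_susp hx uA) wB w) compm0.
Qed.

Lemma coaisle_of_orthogonal (X : D) :
  (forall Y, U Y -> forall f : hom Y X, f = 0) -> W (susp X).
Proof.
move=> orth; have [A [B [f [g [h [uA wB T]]]]]] := t_triangle hx X.
have f0 : f = 0 by apply: orth.
have [|r rg] := dist_weak_cokernel T (t := idm X).
  by rewrite f0 compm0.
suff gr : g \oc r = idm B.
  apply: (t_iso_closed_r hx _ wB); apply: susp_preserves_isomorphic.
  by exists r, g.
have [|w /esym e] := dist_weak_cokernel2 T (t := g \oc r - idm B).
  by rewrite compm_add_l compNm -compm_assoc rg compm_id_l compm_id_r subrr.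
apply/subr0_eq; rewrite e.
by rewrite (t_hom hx (t_susp hx uA) wB w) comp0m.
Qed.

Lemma W_orthogonal (X : D) :
  W X <-> forall Y, U Y -> forall f : hom (susp Y) X, f = 0.
Proof.
have [X' [a [b [ba ab]]]] := susp_ess_surj X; split=> [wX Y uY f|orth].
  have [f' ef] := suspm_full (b \oc f).
  rewrite -[f]compm_id_l -ab -compm_assoc -ef (t_hom hx uY _ f').
    by rewrite suspm0 compm0.
  by apply: (t_iso_closed_r hx _ wX); exists b, a.
apply: (t_iso_closed_r hx (X := susp X')); first by exists a, b.
apply: coaisle_of_orthogonal => Y uY f; apply: suspm_faithful.
by rewrite -[suspm f]compm_id_l -ba -compm_assoc (orth Y uY (a \oc suspm f)) compm0 suspm0.
Qed.

Lemma W_desusp (X : D) : W (susp X) -> W X.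
Proof.
by move=> wX; apply/W_orthogonal => Y uY f; apply: (t_hom hx (t_susp hx uY)).
Qed.

Lemma W_desusp_iter j k (X : D) :
  (j <= k)%N -> W (susp_iter k X) -> W (susp_iter j X).
Proof.
move=> /subnK <-; elim: (k - j)%N => [//|i IH] wX.
by apply: IH; apply: W_desusp.
Qed.

(** This closure property and the next hold because [W] is the right orthogonal
    of [susp U]; the second one also uses that [susp U] is contained in [U],
    because its proof suspends the test map once more. *)
Lemma W_extension k (X Y Z : D) (f : hom X Y) (g : hom Y Z)
    (h : hom Z (susp X)) :
  dist f g h -> W (susp_iter k X) -> W (susp_iter k Z) -> W (susp_iter k Y).
Proof.
move=> /(dist_iter k)[f' [g' [h' T]]] /W_orthogonal wX /W_orthogonal wZ.
apply/W_orthogonal => Q uQ t.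
have [|s <-] := dist_weak_kernel T (t := t); first exact: wZ.
by rewrite (wX Q uQ s) compm0.
Qed.

Lemma W_fiber k (X Y Z : D) (f : hom X Y) (g : hom Y Z) (h : hom Z (susp X)) :
  dist f g h -> W (susp_iter k Y) -> W (susp_iter k Z) -> W (susp_iter k X).
Proof.
move=> /(dist_iter k)[f' [g' [h' T]]] /W_orthogonal wY /W_orthogonal wZ.
apply/W_orthogonal => Q uQ t; apply: suspm_faithful; rewrite suspm0.
have [|s <-] := dist_weak_kernel3 T (t := suspm t).
  by rewrite -suspm_comp (wY Q uQ (f' \oc t)) suspm0.
by rewrite (wZ _ (t_susp hx uQ) s) compm0.
Qed.

Lemma U_extension k (X Y Z : D) (f : hom X Y) (g : hom Y Z)
    (h : hom Z (susp X)) :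
  dist f g h -> U (susp_iter k X) -> U (susp_iter k Z) -> U (susp_iter k Y).
Proof.
move=> /(dist_iter k)[f' [g' [h' T]]] uX uZ.
apply: aisle_of_orthogonal => Q wQ t.
have [|s <-] := dist_weak_cokernel T (t := t); first exact: (t_hom hx uX wQ).
by rewrite (t_hom hx uZ wQ s) comp0m.
Qed.

(** An aisle is a left orthogonal, so it is closed under coproducts for every
    t-structure. *)
Lemma U_coproduct k (I : index_set) (B : I -> D) (c : coproduct B) :
  (forall i, U (susp_iter k (B i))) -> U (susp_iter k c).
Proof.
move=> uB; rewrite -iter_coproductE.
apply: aisle_of_orthogonal => Q wQ t.
apply: (coproduct_ext (c := iter_coproduct c k)) => i.
by rewrite comp0m; apply: (t_hom hx (uB i) wQ).
Qed.

(** The triangle of [X] at level [k + 1] desuspends the one of [susp X] at level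
    [k]: the first map lifts along the suspension, and its cone suspends to
    the given one because cones are unique. *)
Lemma truncation k (X : D) : exists (A B : D) (f : hom A X) (g : hom X B) h,
  [/\ U (susp_iter k A), W (susp_iter k (susp B)) & dist f g h].
Proof.
elim: k X => [|k IH] X; first exact: (t_triangle hx X).
have [A0 [B0 [f0 [g0 [h0 [uA0 wB0 T0]]]]]] := IH (susp X).
have [A [a [a' [a'a aa']]]] := susp_ess_surj A0.
have [f ef] := suspm_full (f0 \oc a).
have [B [g [h T]]] := dist_cone f.
exists A, B, f, g, h; split=> //; rewrite /susp_iter iterSr.
  apply: (t_iso_closed_l hx _ uA0); apply: iter_preserves_isomorphic.
  by exists a', a.
apply: (t_iso_closed_r hx _ wB0); apply: iter_preserves_isomorphic.
apply: susp_preserves_isomorphic.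
suff T1 : dist (suspm f) g0 (suspm a' \oc h0).
  exact: cone_unique T1 (dist_susp T).
apply: (dist_iso (u := a') (v := idm _) (w := idm _) _ _ _ _ _ _ T0).
- by exists a.
- exact: is_iso_id.
- exact: is_iso_id.
- by rewrite ef -compm_assoc aa' compm_id_l compm_id_r.
- by rewrite compm_id_l compm_id_r.
- by rewrite compm_id_r.
Qed.

(** * AET4 for the heart of a 0-smashing t-structure *)

Lemma heart_coproduct_exists n (I : index_set)
    (B : I -> heart_extri n U W) :
  has_coproducts D -> smashing 0 W ->
  exists c : coproduct (fun i => sval (B i)), extended_heart n U W c.
Proof.
move=> hD hs; have [c] := hD I (fun i => sval (B i)); exists c; split.
  have [Y [wY e]] := hs I _ (fun i => proj1 (svalP (B i))) c.
  exact: (t_iso_closed_r hx e wY).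
exact: U_coproduct (fun i => proj2 (svalP (B i))).
Qed.

Definition full_coproduct (C : preadditive) (P : C -> Prop) (I : index_set)
    (B : I -> full_subcategory P) (c : coproduct (fun i => sval (B i)))
    (Pc : P c) : coproduct B :=
  @Coproduct (full_subcategory P) I B (exist _ (c : C) Pc)
    (inj c) (fun X f => desc c f) (fun X f => @desc_inj _ _ _ c (sval X) f)
    (fun X f g => @desc_uniq _ _ _ c (sval X) f g).

(** Gamma is the family of the [suspm (inj i) \oc eta i], read as one map from
    the coproduct; this choice is forced by compatibility with inclusions. *)
Lemma AET4_of_smashing n :
  has_coproducts D -> smashing 0 W -> AET4 (heart_extri n U W).
Proof.
move=> hD hs; split=> [I _ B|I _].
  have [c Pc] := heart_coproduct_exists B hD hs.
  by exists; exact: full_coproduct Pc.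
have [cop Pcop] := dependent_choice_family
  (fun B : I -> heart_extri n U W => heart_coproduct_exists B hD hs).
exists (fun B => full_coproduct (Pcop B)).
exists (fun B A eta => desc (cop B)
  (fun i => suspm (inj (cop (fun=> A)) i) \oc eta i)).
split.
- move=> B A eta eta'; apply: (coproduct_ext (c := cop B)) => i /=.
  by rewrite compm_add_l !(desc_inj (cop B)) compm_add_r.
- move=> B B' A A' b a eta; apply: (coproduct_ext (c := cop B')) => i /=.
  rewrite (desc_inj (cop B')) -!compm_assoc (cop_map_inj (cop B') (cop B)).
  rewrite [desc (cop B) _ \oc _]compm_assoc (desc_inj (cop B)).
  rewrite !compm_assoc -!suspm_comp.
  by rewrite (cop_map_inj (cop (fun=> A)) (cop (fun=> A'))).
- by move=> B E A eta f g T; apply: coproduct_dist.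
- by move=> B A eta j /=; rewrite (desc_inj (cop B)).
Qed.

(** * From AET3.5 to 0-smashing *)

(** Rotating the cone triangle [B i -> c -> E i] of the inclusion of [B i] shows
    that [- suspm (inj c i)], an extension of [susp (B i)] by [c], is realized
    by [c -> E i -> susp (B i)]; in particular [E i] is in the heart. Gamma
    turns these extensions, which do have a common second argument, into a
    triangle from [c^(I)] to the coproduct of the [E i] with cone in [W], hence
    every map from [U] to [c^(I)] that dies in the coproduct of the [E i] is
    zero. Maps from [U] to [c] give such maps along the split monomorphism
    induced by the inclusions, as [B i -> c -> E i] is zero. *)
Lemma heart_coproduct_coaisle n (I : index_set) (B : I -> D)
    (c : coproduct B) :
  inhabited I -> AET35 (heart_extri n U W) ->
  (forall i, W (susp (B i))) -> (forall i, desusp_sub (n - 1) U (B i)) ->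
  W c -> W (susp c).
Proof.
move=> I0 [_ /(_ I I0)[cop [Gamma [_ _ real]]]] wB uB wc.
have uc : desusp_sub (n - 1) U c by apply: U_coproduct.
pose A : heart_extri n U W := exist _ (c : D) (conj wc uc).
have uSB i : desusp_sub (n - 1) U (susp (B i)).
  by rewrite /desusp_sub /susp_iter -iterSr; apply/(t_susp hx)/uB.
pose SB i : heart_extri n U W := exist _ (susp (B i)) (conj (wB i) (uSB i)).
have [E Etri] : exists E : I -> heart_extri n U W, forall i,
    exists (f : hom (c : D) (sval (E i))) (g : hom (sval (E i)) (susp (B i))),
      dist (inj c i) f g.
  apply: (dependent_choice_family (P := fun i (E : heart_extri n U W) =>
    exists (f : hom (c : D) (sval E)) (g : hom (sval E) (susp (B i))),
      dist (inj c i) f g)) => i.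
  have [K [f [g T]]] := dist_cone (inj c i).
  have T1 := (dist_rotate _ _ _).1 T.
  have wK : W K := W_extension (k := 0) T1 wc (wB i).
  have uK : desusp_sub (n - 1) U K := U_extension T1 uc (uSB i).
  by exists (exist _ K (conj wK uK)), f, g.
have [f ftri] := dependent_choice_family Etri.
have [g T] := dependent_choice_family ftri.
pose eta i : ext (SB i) A := - suspm (inj c i).
have /(real SB E A eta) TG i : realizes (eta i) (f i : hom A (E i)) (g i).
  exact: (dist_rotate _ _ _).1 (T i).
set cA := cop (fun=> A) in TG *; set cE := cop E in TG *.
(* The data produced in the heart, read as objects and morphisms of [D]. *)
pose cI : D := sval (cop_obj cA); pose cE' : D := sval (cop_obj cE).
pose j i : hom (c : D) cI := inj cA i.
pose F : hom cI cE' := cop_map cA cE (fun i => f i : hom A (E i)).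
pose r : hom cI c := desc cA (fun=> idm A).
have Fj i : F \oc j i = (inj cE i : hom (sval (E i)) cE') \oc f i.
  exact: (cop_map_inj cA cE).
have rj i : r \oc j i = idm (c : D) by apply: (@desc_inj _ _ _ cA A (fun=> idm A) i).
pose m : hom (c : D) cI := desc c (fun i => j i \oc inj c i).
have Fm : F \oc m = 0.
  apply: (coproduct_ext (c := c)) => i.
  rewrite comp0m -compm_assoc desc_inj compm_assoc Fj -compm_assoc.
  by rewrite (dist_comp1 (T i)) compm0.
have rm : r \oc m = idm (c : D).
  apply: (coproduct_ext (c := c)) => i.
  by rewrite -compm_assoc desc_inj compm_assoc rj.
apply: coaisle_of_orthogonal => Y uY t.
have mt0 : m \oc t = 0.
  apply: suspm_faithful; rewrite suspm0.
  have [|s <-] := dist_weak_kernel3 TG (t := suspm (m \oc t)).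
    by rewrite -suspm_comp compm_assoc Fm comp0m suspm0.
  have /W_orthogonal wP := proj1 (svalP (cop_obj (cop SB))).
  by rewrite (wP Y uY s) compm0.
by rewrite -[t]compm_id_l -rm -compm_assoc mt0 compm0.
Qed.

(** Since the suspension is an autoequivalence, this is being [k]-smashing with
    the shift moved from the coproduct to the family. In this form the
    condition for [k = 0] is literally closure of [W] under coproducts, and
    the induction lowering [k] changes only the families. *)
Definition coproducts_in_W (I : index_set) (k : nat) : Prop :=
  forall B : I -> D, (forall i, desusp_sub k W (B i)) ->
  forall c : coproduct B, W c.

(** The coproduct of the suspended family is the suspended coproduct, which
    smashing puts in [susp_sub k W]; the suspension reflects isomorphisms. *)
Lemma coproducts_in_W_of_smashing (I : index_set) k :
  smashing k W -> coproducts_in_W I k.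
Proof.
move=> hs B wB c.
have [Y [wY]] := hs I _ wB (iter_coproduct c k).
rewrite iter_coproductE => e; apply: (t_iso_closed_r hx _ wY).
elim: k {hs wB} e => [//|k IH] /susp_reflects_isomorphic; exact: IH.
Qed.

(** Write the given family as [susp (Y i)] and truncate each [Y i] at level
    [n - 1] into [A i -> Y i -> Z i]. The coproduct of the [A i] is in [W] by
    the assumption for [k + 1] and hence in [desusp_sub 1 W] by
    [heart_coproduct_coaisle]; that of the [Z i] is in [desusp_sub 1 W] by the
    assumption for [n - 1], and an extension of the two remains there. *)
Lemma coproducts_in_W_descent n (I : index_set) k :
  has_coproducts D -> inhabited I -> AET35 (heart_extri n U W) ->
  coproducts_in_W I (n - 1) -> (k < n - 1)%N ->
  coproducts_in_W I k.+1 -> coproducts_in_W I k.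
Proof.
move=> hD I0 aet Sn kn Sk B wB c.
have [Y Ysusp] := dependent_choice_family (fun i => susp_ess_surj (B i)).
have wY i : W (susp_iter k.+1 (Y i)).
  rewrite /susp_iter iterSr; apply: (t_iso_closed_r hx _ (wB i)).
  exact/iter_preserves_isomorphic/isomorphic_sym.
have [A /dependent_choice_family[Z]] :=
  dependent_choice_family (fun i => truncation (n - 1) (Y i)).
move=> /dependent_choice_family[f /dependent_choice_family[g]].
move=> /dependent_choice_family[h T].
have uA i : desusp_sub (n - 1) U (A i) by have [] := T i.
have wZ i : W (susp_iter (n - 1) (susp (Z i))) by have [] := T i.
have {}T i : dist (f i) (g i) (h i) by have [] := T i.
have wA i : W (susp_iter k.+1 (A i)).
  apply: (W_fiber (T i) (wY i)); apply: W_desusp_iter kn _.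
  by apply: W_desusp; move: (wZ i); rewrite /susp_iter -iterSr.
have [cA] := hD I A; have [cY] := hD I Y; have [cZ] := hD I Z.
have wcA : W (susp cA).
  apply: (heart_coproduct_coaisle I0 aet _ uA); last exact: Sk.
  by move=> i; apply: (W_desusp_iter (j := 1%N) _ (wA i)).
have wcZ : W (susp cZ) by apply: (Sn _ wZ (susp_coproduct cZ)).
have wcY : W (susp cY).
  exact: (W_extension (k := 1) (coproduct_dist cA cY cZ T) wcA wcZ).
apply: (t_iso_closed_r hx _ wcY).
exact: (coproduct_isomorphic (susp_coproduct cY) c Ysusp).
Qed.

Lemma smashing_of_AET35 n :
  has_coproducts D -> smashing (n - 1) W -> AET35 (heart_extri n U W) ->
  smashing 0 W.
Proof.
move=> hD hs aet I B wB c.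
exists c; split; last by exists (idm _); apply: is_iso_id.
have [I0|I0] := classic (inhabited I); last first.
  (* AET3.5 says nothing about the empty coproduct, which is a zero object. *)
  apply/W_orthogonal => Y uY f.
  suff id0 : idm (c : D) = 0 by rewrite -[f]compm_id_l id0 comp0m.
  by apply: (coproduct_ext (c := c)) => i; case: I0.
have Sn := coproducts_in_W_of_smashing (I := I) hs.
suff S0 : coproducts_in_W I 0 by apply: S0 wB c.
suff S j : (j <= n - 1)%N -> coproducts_in_W I (n - 1 - j).
  by rewrite -(subnn (n - 1)%N); apply: S.
elim: j => [|j IH] lt; first by rewrite subn0.
apply: (coproducts_in_W_descent hD I0 aet Sn).
  by rewrite ltn_subrL; apply: leq_ltn_trans lt.
by rewrite subnSK //; apply: IH; apply: ltnW.
Qed.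

End TStructure.

Local Close Scope ring_scope.

Theorem theorem4p9 (n : nat) (D : triangulated) (U W : D -> Prop)
    (hn : 2 <= n) (hD : has_coproducts D) (hx : t_structure U W)
    (hs : smashing (n - 1) W) :
  (smashing 0 W <-> AET4 (heart_extri n U W)) /\
  (AET4 (heart_extri n U W) <-> AET35 (heart_extri n U W)).
Proof.
have ab := AET4_of_smashing hx n hD.
have bc : AET4 (heart_extri n U W) -> AET35 (heart_extri n U W).
  move=> [cop aet]; split=> // I I0.
  by have [c [G [? ? ? _]]] := aet I I0; exists c, G.
have ca := smashing_of_AET35 hx hD hs.
by split; split=> [H | H]; auto.
Qed.
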